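(* Let $n_1,\dots,n_b\ge 2$ and $m\ge1$ be integers, and let $A$ be the ring $\mathbb{Z}_{n_1}\oplus\cdots\oplus\mathbb{Z}_{n_b}$. Then $$\mathsf{D}_m(A)\ge\sum_{j=1}^b L(n_j,m)-(b-1)m.$$
   Context: For a finite commutative ring $A$, a sequence over $A$ is a finite multiset of elements of $A$; its length counts multiplicity, and a subsequence is a sub-multiset. For $S=(a_1,\dots,a_\ell)$ and $m\ge1$, $e_m(S)=\sum_{1\le i_1<\dots<i_m\le \ell}\prod_{j=1}^m a_{i_j}$. $\mathsf{D}_m(A)$ is the smallest positive integer $t$ such that every sequence $S$ over $A$ with $|S|\ge t$ contains a subsequence $S'$ with $|S'|\ge m$ and $e_m(S')=0$. Ring operations on the direct product are componentwise. For integers $n,m\ge1$, $L(n,m)$ is the smallest integer $t\ge m+1$ such that $\binom{t}{m}\equiv0\pmod n$. *)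

(* Defs.v *)
From HB Require Import structures.
From mathcomp Require Import all_boot all_order all_algebra.
From mathcomp Require Import boolp classical_sets.

Set Implicit Arguments.
Unset Strict Implicit.
Unset Printing Implicit Defensive.
Import GRing.Theory.

Local Open Scope ring_scope.

(* Direct product of a finite family of finite commutative rings, with the
   componentwise operations; the library has this only for constant families. *)
Section DirectProduct.
Variables (I : finType) (R : I -> finComPzRingType).

Definition dprod_ring : Type := {dffun forall i : I, R i}.

HB.instance Definition _ := Finite.on dprod_ring.

Implicit Types f g h : dprod_ring.

Definition dprod_zero : dprod_ring := [ffun i => 0].
Definition dprod_opp f : dprod_ring := [ffun i => - f i].
Definition dprod_add f g : dprod_ring := [ffun i => f i + g i].
Definition dprod_one : dprod_ring := [ffun i => 1].
Definition dprod_mul f g : dprod_ring := [ffun i => f i * g i].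

Fact dprod_addA : associative dprod_add.
Proof. by move=> f g h; apply/ffunP=> i; rewrite !ffunE addrA. Qed.
Fact dprod_addC : commutative dprod_add.
Proof. by move=> f g; apply/ffunP=> i; rewrite !ffunE addrC. Qed.
Fact dprod_add0 : left_id dprod_zero dprod_add.
Proof. by move=> f; apply/ffunP=> i; rewrite !ffunE add0r. Qed.
Fact dprod_addN : left_inverse dprod_zero dprod_opp dprod_add.
Proof. by move=> f; apply/ffunP=> i; rewrite !ffunE addNr. Qed.

HB.instance Definition _ := GRing.isZmodule.Build dprod_ring
  dprod_addA dprod_addC dprod_add0 dprod_addN.

Fact dprod_mulA : associative dprod_mul.
Proof. by move=> f g h; apply/ffunP=> i; rewrite !ffunE mulrA. Qed.
Fact dprod_mulC : commutative dprod_mul.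
Proof. by move=> f g; apply/ffunP=> i; rewrite !ffunE mulrC. Qed.
Fact dprod_mul1 : left_id dprod_one dprod_mul.
Proof. by move=> f; apply/ffunP=> i; rewrite !ffunE mul1r. Qed.
Fact dprod_mulDl : left_distributive dprod_mul dprod_add.
Proof. by move=> f g h; apply/ffunP=> i; rewrite !ffunE mulrDl. Qed.

HB.instance Definition _ := GRing.Zmodule_isComPzRing.Build dprod_ring
  dprod_mulA dprod_mulC dprod_mul1 dprod_mulDl.

End DirectProduct.

(* The junk value 0 is taken when no natural number satisfies P; the lemmas
   davenport_exists and Lbin_exists rule this out for n, m >= 1. *)
Definition least (P : nat -> Prop) : nat :=
  xget 0%N [set t | P t /\ forall u, P u -> (t <= u)%N]%classic.

Lemma leastP (P : nat -> Prop) : (exists t, P t) ->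
  P (least P) /\ forall u, P u -> (least P <= u)%N.
Proof.
move=> [t Pt]; pose Q u := `[< P u >].
have exQ : exists u, Q u by exists t; apply/asboolP.
have [u /asboolP Pu umin] := ex_minnP exQ.
rewrite /least; case: xgetP => [v _ // | /(_ u) []].
by split=> // v Pv; apply: umin; apply/asboolP.
Qed.

(* Multisets are represented by lists; elem_sym is invariant under permutation
   of the list, so sub-multisets may be taken as sublists ("subseq"). *)
Definition elem_sym (A : comPzRingType) (m : nat) (S : seq A) : A :=
  \sum_(I : {set 'I_(size S)} | #|I| == m) \prod_(i in I) S`_i.

Definition davenport_bound (A : finComPzRingType) (m t : nat) : Prop :=
  (0 < t)%N /\
  forall S : seq A, (t <= size S)%N ->
    exists S' : seq A,
      [/\ subseq S' S, (m <= size S')%N & elem_sym m S' = 0].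

Definition davenport (m : nat) (A : finComPzRingType) : nat :=
  least (davenport_bound A m).

Definition Lbin (n m : nat) : nat :=
  least (fun t => (m + 1 <= t)%N /\ 'C(t, m) = 0 %[mod n]).

Lemma Lbin_exists (n m : nat) : (0 < n)%N -> (0 < m)%N ->
  exists t, (m + 1 <= t)%N /\ 'C(t, m) = 0 %[mod n].
Proof.
case: m => // m n0 _; exists (n * (m.+1)`! * m.+2)%N; split.
  by rewrite addn1 leq_pmull // muln_gt0 n0 fact_gt0.
apply/eqP; rewrite mod0n -/(dvdn _ _).
rewrite -(@dvdn_pmul2r (m.+1)`!) ?fact_gt0 // bin_ffact ffactnS.
by rewrite -mulnA dvdn_mulr // dvdn_mulr.
Qed.

Lemma elem_sym_nseq (A : comPzRingType) (m k : nat) (x : A) :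
  elem_sym m (nseq k x) = x ^+ m *+ 'C(k, m).
Proof.
rewrite /elem_sym (eq_bigr (fun=> x ^+ m)) => [|I /eqP Im].
  have card_k : #|'I_(size (nseq k x))| = k by rewrite card_ord size_nseq.
  by rewrite sumr_const -[in RHS]card_k -card_draws cardsE.
rewrite -[in RHS]Im -prodr_const; apply: eq_bigr => i _.
by have := ltn_ord i; rewrite nth_nseq [X in (_ < X)%N -> _]size_nseq => ->.
Qed.

Lemma davenport_exists (A : finComPzRingType) (m : nat) : (0 < m)%N ->
  exists t, davenport_bound A m t.
Proof.
move=> m0; have A0 : (0 < #|A|)%N by apply/card_gt0P; exists 0.
have [k [mk kN]] := Lbin_exists A0 m0.
have k0 : (0 < k)%N by apply: leq_trans mk; rewrite addn1.
exists (#|A| * k)%N; split=> [|S leS]; first by rewrite muln_gt0 A0.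
have [x kx] : exists x, (k <= count_mem x S)%N.
  apply/existsP; apply: contraLR leS; rewrite negb_exists -ltnNge => /forallP lt.
  rewrite -(sum1_size S) (partition_big id predT) //=.
  rewrite -sum_nat_const; apply: (@leq_ltn_trans (\sum_(x : A) (count_mem x S))).
    by apply: leq_sum => x _; rewrite -sum1_count.
  rewrite (bigD1 (0 : A)) //= [ltnRHS](bigD1 (0 : A)) //=.
  rewrite -addSn leq_add //; first by rewrite ltnNge.
  by apply: leq_sum => x _; rewrite ltnW // ltnNge.
exists (nseq k x); split.
- apply: subseq_trans (filter_subseq (pred1 x) S).
  have /all_pred1P -> := filter_all (pred1 x) S.
  by rewrite size_filter -(subnKC kx) nseqD prefix_subseq.
- by rewrite size_nseq; apply: leq_trans mk; rewrite addn1.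
- rewrite elem_sym_nseq; have /dvdnP[q ->] : (#|A| %| 'C(k, m))%N by rewrite /dvdn kN mod0n.
  rewrite mulnC mulrnA.
  suff -> : x ^+ m *+ #|A| = 0 by rewrite mul0rn.
  apply: (@addrI _ (\sum_(y : A) y)); rewrite addr0 -sumr_const -big_split /=.
  by rewrite [RHS](reindex_inj (@addIr _ (x ^+ m))).
Qed.

Lemma davenportP (A : finComPzRingType) (m : nat) : (0 < m)%N ->
  davenport_bound A m (davenport m A) /\
  forall t, davenport_bound A m t -> (davenport m A <= t)%N.
Proof. by move=> m0; apply/leastP/davenport_exists. Qed.

Lemma LbinP (n m : nat) : (0 < n)%N -> (0 < m)%N ->
  [/\ (m + 1 <= Lbin n m)%N, 'C(Lbin n m, m) = 0 %[mod n] &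
      forall t, (m + 1 <= t)%N -> 'C(t, m) = 0 %[mod n] -> (Lbin n m <= t)%N].
Proof.
move=> n0 m0; have [[? ?] lmin] := leastP (Lbin_exists n0 m0).
by split=> // t ? ?; apply: lmin.
Qed.

(* Main.v *)
(** Let [v_i] be the element of the ring whose first [i] coordinates are [1] and
    whose other coordinates are [0].  Take [Lbin (n_k) m - m] copies of
    [v_(k+1)] for each [k < b], and [m - 1] more copies of [v_b].  In coordinate
    [k], a subsequence has [e_m = 'C(c, m)], where [c] counts its terms [v_i]
    with [i > k].  If [e_m = 0] in every coordinate, then by downward induction
    on [k] fewer than [m] terms have coordinate [k] equal to [1]: passing from
    [k + 1] to [k] adds at most [Lbin (n_k) m - m] terms, so the count stays
    below [Lbin (n_k) m], where the vanishing of ['C(c, m)] forces [c < m].  For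
    [k = 0] this bounds the whole length. *)
Require Import Defs.
From HB Require Import structures.
From mathcomp Require Import all_boot all_order all_algebra.
From mathcomp Require Import zify.

Set Implicit Arguments.
Unset Strict Implicit.
Unset Printing Implicit Defensive.
Import GRing.Theory.

Local Open Scope ring_scope.

Section Projection.
Variables (I : finType) (R : I -> finComPzRingType) (i : I).

Definition dprod_proj (f : dprod_ring R) : R i := f i.

Fact dprod_proj_is_zmod_morphism : zmod_morphism dprod_proj.
Proof. by move=> f g; rewrite /dprod_proj !ffunE. Qed.

Fact dprod_proj_is_monoid_morphism : monoid_morphism dprod_proj.
Proof. by split=> [|f g]; rewrite /dprod_proj !ffunE. Qed.

HB.instance Definition _ := GRing.isZmodMorphism.Build _ _ dprod_proj
  dprod_proj_is_zmod_morphism.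
HB.instance Definition _ := GRing.isMonoidMorphism.Build _ _ dprod_proj
  dprod_proj_is_monoid_morphism.

End Projection.

(** Frees the index type from [size S], so that sums for [S] and [map f S] can be compared
    termwise. *)
Lemma elem_symE (A : comPzRingType) (m k : nat) (S : seq A) : size S = k ->
  elem_sym m S = \sum_(I : {set 'I_k} | #|I| == m) \prod_(i in I) S`_i.
Proof. by move=> <-. Qed.

Lemma elem_sym_rmorph (A B : comPzRingType) (f : {rmorphism A -> B}) (m : nat)
  (S : seq A) : f (elem_sym m S) = elem_sym m (map f S).
Proof.
rewrite (elem_symE m (size_map f S)) rmorph_sum; apply: eq_bigr => I _.
by rewrite rmorph_prod; apply: eq_bigr => i _; rewrite (nth_map 0).
Qed.

(** The product over [I] is 1 if [p] holds at every position in [I] and 0 otherwise, so the sum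
    counts the [m]-subsets of the set [B] of positions where [p] holds. *)
Lemma elem_sym_indicator (A : comPzRingType) (T : Type) (p : pred T) (m : nat)
  (s : seq T) : elem_sym m [seq (p x)%:R : A | x <- s] = 'C(count p s, m)%:R.
Proof.
rewrite (elem_symE m (size_map _ s)).
pose B := [set i : 'I_(size s) | p (tnth (in_tuple s) i)].
have -> : count p s = #|B|.
  rewrite -sum1_count big_tnth -sum1_card; apply: eq_bigl => i.
  by rewrite inE.
rewrite -cards_draws -sum1_card natr_sum.
under [RHS]eq_bigl => I do rewrite inE andbC.
rewrite [RHS]big_mkcondr; apply: eq_bigr => I _.
have nthE (i : 'I_(size s)) : [seq (p x)%:R : A | x <- s]`_i = (i \in B)%:R.
  have x0 := tnth (in_tuple s) i.
  by rewrite (nth_map x0) // inE (tnth_nth x0).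
case: ifPn => [/subsetP sIB | /subsetPn[i Ii /negbTE nBi]].
  by apply: big1 => i /sIB Bi; rewrite nthE Bi.
by rewrite (bigD1 i) //= nthE nBi mul0r.
Qed.

Lemma natr_Zp_eq0 (n k : nat) : (1 < n)%N -> k%:R = 0 :> 'Z_n -> k = 0 %[mod n].
Proof. by move=> n1 k0; rewrite -(val_Zp_nat n1) k0 mod0n. Qed.

(** Minimality of [Lbin n m] excludes [c > m], and [c = m] would give 1 = 0 modulo [n]. *)
Lemma bin_mod_eq0_lt (n m c : nat) : (1 < n)%N -> (0 < m)%N ->
  (c < Lbin n m)%N -> 'C(c, m) = 0 %[mod n] -> (c < m)%N.
Proof.
move=> n1 m0 ltcL C0; have [_ _ Lmin] := LbinP (ltnW n1) m0.
case: (ltngtP c m) => // [ltmc | cm].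
  by have := Lmin c; rewrite addn1 => /(_ ltmc C0); rewrite leqNgt ltcL.
by move: C0; rewrite cm binn mod0n modn_small.
Qed.

Lemma count_nseq_enum (b : nat) (l : 'I_b -> nat) (k : 'I_b) :
  count_mem (k : nat) (flatten [seq nseq (l i) (i : nat) | i <- enum 'I_b]) = l k.
Proof.
rewrite count_flatten -map_comp sumnE big_map big_enum /= (bigD1 k) //=.
rewrite count_nseq /= eqxx mul1n big1 ?addn0 // => i ik.
by rewrite count_nseq /= (inj_eq val_inj) (negbTE ik).
Qed.

Theorem theorem12 (b : nat) (n : 'I_b -> nat) (m : nat)
  (hb : (1 <= b)%N) (hn : forall j : 'I_b, (2 <= n j)%N) (hm : (1 <= m)%N) :
  (davenport m (dprod_ring (fun j : 'I_b => 'Z_(n j))) >=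
    \sum_(j < b) Lbin (n j) m - (b - 1) * m)%N.
Proof.
set A := dprod_ring _.
pose l k := (Lbin (n k) m - m)%N.
have Lm k : (m < Lbin (n k) m)%N.
  by have [] := LbinP (ltnW (hn k)) hm; rewrite addn1.
pose v (i : nat) : A := [ffun k : 'I_b => (k <= i)%:R].
(* The index [i] stands for [v_(i+1)] of the header, with [i = b] giving the
   same element as [i = b - 1]. *)
pose s := flatten [seq nseq (l k) (k : nat) | k <- enum 'I_b] ++ nseq m.-1 b.
have count_s (k : 'I_b) : count_mem (k : nat) s = l k.
  rewrite count_cat count_nseq_enum count_nseq /=.
  by rewrite gtn_eqF // mul0n addn0.
have count_s_b : (count (leq b) s < m)%N.
  rewrite count_cat count_nseq leqnn mul1n count_flatten -map_comp sumnE.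
  rewrite big_map big_enum big1 ?add0n ?prednK // => k _ /=.
  by rewrite count_nseq leqNgt ltn_ord.
have size_s : size s = (\sum_(k < b) l k + m.-1)%N.
  rewrite size_cat size_flatten /shape -map_comp size_nseq sumnE big_map big_enum.
  by congr addn; apply: eq_bigr => k _ /=; rewrite size_nseq.
have sum_L : (\sum_(k < b) Lbin (n k) m = \sum_(k < b) l k + b * m)%N.
  rewrite -[b in (b * m)%N]card_ord -sum_nat_const -big_split /=.
  by apply: eq_bigr => k _; rewrite subnK // ltnW.
have [[_ bound] _] := davenportP A hm.
rewrite leqNgt; apply/negP => ltD.
have [|S' [/subseqP[w _ ->]]] := bound (map v s).
  (* The claimed bound equals [\sum_(k < b) l k + m], one more than the length of [s]. *)
  by rewrite size_map size_s; move: ltD; rewrite sum_L; nia.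
rewrite -map_mask size_map; set s' := mask w s => le_m e0.
have count_le (p : pred nat) : (count p s' <= count p s)%N.
  exact/leq_count_subseq/mask_subseq.
have few j : (j <= b)%N -> (count (leq (b - j)) s' < m)%N.
  elim: j => [_|j IHj ltjb].
    by rewrite subn0; apply: leq_ltn_trans (count_le _) count_s_b.
  have ltkb : (b - j.+1 < b)%N by lia.
  pose k := Ordinal ltkb.
  apply: (bin_mod_eq0_lt (hn k) hm).
    have -> : count (leq (b - j.+1)) s' =
        (count_mem (k : nat) s' + count (leq (b - j)) s')%N.
      rewrite -count_predUI [X in (_ + X)%N](@eq_count _ _ pred0) ?count_pred0.
        by rewrite addn0; apply: eq_count => i /=; lia.
      by move=> i /=; lia.
    (* At most [l k] terms equal [k] and at most [m - 1] exceed it, while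
       [Lbin (n k) m = l k + m]. *)
    rewrite -(subnK (ltnW (Lm k))) -addnS leq_add ?IHj ?(ltnW ltjb) //.
    by rewrite -[leqRHS]count_s.
  apply: natr_Zp_eq0 => //.
  (* Projection to coordinate [k] turns [v i] into the indicator of [k <= i]. *)
  have := congr1 (dprod_proj k) e0; rewrite elem_sym_rmorph rmorph0 => <-.
  rewrite -elem_sym_indicator -map_comp; congr elem_sym.
  by apply: eq_map => i /=; rewrite /dprod_proj ffunE.
by have := few b (leqnn b); rewrite subnn count_predT ltnNge le_m.
Qed.
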